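(* Let $(X,\rho)$ be a geometrically doubling quasi-metric space and suppose $\mu$ is a positive Borel measure on $X$ with the property that $\mu(B)<\infty$ for all balls $B\subseteq X$. Let $\mathscr D$ be a system of dyadic cubes on $X$ with the distinguished center point property, and for each $Q\in\mathscr D$ let the children $Q_1,\dots,Q_{M_Q}$ of $Q$ be indexed so that $\sum_{j=u}^{M_Q}\mu(Q_j)\ge[1-(u-1)M_Q^{-1}]\mu(Q)$ for every $u=1,\dots,M_Q$, and put $E_u:=\bigcup_{j=u}^{M_Q}Q_j$. For each $Q\in\mathscr D$, let $h^Q_0:=\mu(Q)^{-1/2}1_Q$, and for $u=1,2,\dots,M_Q-1$ let $$h^Q_u:=\begin{cases}0,&\text{if }\mu(Q_u)=0;\\ a_u1_{Q_u}-b_u1_{E_{u+1}},&\text{if }\mu(Q_u)>0,\end{cases}$$ where $$a_u:=\frac{\mu(E_{u+1})^{1/2}}{\mu(Q_u)^{1/2}\mu(E_u)^{1/2}},\qquad b_u:=\frac{\mu(Q_u)^{1/2}}{\mu(E_u)^{1/2}\mu(E_{u+1})^{1/2}}.$$ The Haar functions $h^Q_u$, $Q\in\mathscr D$, $u=0,1,\dots,M_Q-1$, have the following properties: (i) each $h^Q_u$ is a simple Borel-measurable real function on $X$; (ii) each $h^Q_u$ is supported on $Q$; (iii) each $h^Q_u$ is constant on each child $R$ of $Q$; (iv) $\int h^Q_u\,d\mu=0$ for $u=1,2,\dots,M_Q-1$ (cancellation); (v) $\langle h^Q_u,h^Q_{u'}\rangle=0$ if $u\ne u'$, $u,u'\in\{0,1,\dots,M_Q-1\}$;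 (vi) the collection $\{h^Q_u:u=0,1,\dots,M_Q-1\}$ is an orthogonal basis for the vector space $V(Q)$ of all functions on $Q$ that are constant on each child $R$ of $Q$; (vii) for $u=1,2,\dots,M_Q-1$, if $h^Q_u\not\equiv0$ then $\|h^Q_u\|_{L^p(X,\mu)}\simeq\mu(Q_u)^{\frac1p-\frac12}$ for $1\le p\le\infty$; (viii) for $u=0,1,\dots,M_Q-1$, we have $\|h^Q_u\|_{L^1(X,\mu)}\cdot\|h^Q_u\|_{L^\infty(X,\mu)}\simeq1$.
   Context: **Setting.** A quasi-metric on $X$ is a map $\rho:X\times X\to[0,\infty)$ which is symmetric, vanishes exactly on the diagonal, and satisfies $\rho(x,y)\le A_0[\rho(x,z)+\rho(z,y)]$ with a constant $A_0\ge1$. It is geometrically doubling if there is $A_1\in\mathbb N$ such that every ball $B(x,r)=\{y:\rho(x,y)<r\}$ can be covered by at most $A_1$ balls of radius $r/2$. Balls are assumed $\mu$-measurable. The measure $\mu$ is not assumed to be doubling. **Dyadic cubes.** A system of dyadic cubes with parameters $\delta\in(0,1)$, $0<c_1\le C_1<\infty$ is a countable family $\mathscr D=\bigcup_{k\in\mathbb Z}\mathscr D_k$, $\mathscr D_k=\{Q^k_\alpha:\alpha\in\mathscr A_k\}$, of Borel sets (a cube is understood together with its generation $k$) with: $X=\bigcup_\alpha Q^k_\alpha$ (disjoint union) for each $k$; if $\ell\ge k$ then either $Q^\ell_\beta\subseteq Q^k_\alpha$ or $Q^k_\alpha\cap Q^\ell_\beta=\emptyset$; for each $(k,\alpha)$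 and $\ell\le k$ there is a unique $\beta$ with $Q^k_\alpha\subseteq Q^\ell_\beta$; each $Q^k_\alpha$ is the union of the cubes of $\mathscr D_{k+1}$ it contains, whose number is between $1$ and a fixed constant $M$ depending only on $A_0,A_1,\delta$; there are center points $x^k_\alpha\in Q^k_\alpha$ with $B(x^k_\alpha,c_1\delta^k)\subseteq Q^k_\alpha\subseteq B(x^k_\alpha,C_1\delta^k)=:B(Q^k_\alpha)$; and if $\ell\ge k$ and $Q^\ell_\beta\subseteq Q^k_\alpha$ then $B(Q^\ell_\beta)\subseteq B(Q^k_\alpha)$. Distinguished center point property: there is $x_0\in X$ such that for every $k\in\mathbb Z$ there is $\alpha$ with $x_0=x^k_\alpha$. For $Q\in\mathscr D_k$, the children of $Q$ are the elements of $\mathrm{Ch}(Q)=\{R\in\mathscr D_{k+1}:R\subseteq Q\}$, and $M_Q:=\#\mathrm{Ch}(Q)\in[1,M]$. (An indexing as required always exists, e.g. by increasing measure.) **Notation.** $\langle f,g\rangle=\int fg\,d\mu$. $A\simeq B$ means $c^{-1}A\le B\le cA$ with a constant $c\ge1$ independent of $Q$ and $u$; for $p=\infty$, $1/p=0$.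
   Formalization: If a child of Q is null, some h_u is 0 (h_0 is undefined if μ(Q)=0; read as 0), so (vi) and (viii) fail as written: (vi) is proved literally when all children have positive measure and otherwise μ-a.e. with zero functions discarded; (viii) is stated for h_u≢0. *)

(* Defs.v *)
From HB Require Import structures.
From mathcomp Require Import all_boot all_order all_algebra.
From mathcomp Require Import finmap.
From mathcomp Require Import all_classical all_reals all_analysis.

Set Implicit Arguments.
Unset Strict Implicit.
Unset Printing Implicit Defensive.

Import Order.TTheory GRing.Theory Num.Theory.

Local Open Scope classical_set_scope.
Local Open Scope ring_scope.

Section QuasiMetric.
Context {R : realType} {X : choiceType}.
Implicit Types (rho : X -> X -> R) (x y z : X) (r : R).

Definition quasi_metric rho (A0 : R) : Prop :=
  [/\ forall x y, 0 <= rho x y,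
      forall x y, rho x y = rho y x,
      forall x y, rho x y = 0 <-> x = y,
      1 <= A0 &
      forall x y z, rho x y <= A0 * (rho x z + rho z y)].

Definition qball rho x r : set X := [set y | rho x y < r].

Definition geometrically_doubling rho (A1 : nat) : Prop :=
  forall x r, 0 < r -> exists s : seq X, (size s <= A1)%N /\
    qball rho x r `<=` \bigcup_(z in [set` s]) qball rho z (r / 2).

(* The topology of a quasi-metric; quasi-metric balls need not be open. *)
Definition qopen rho : set (set X) :=
  [set U | forall x, U x -> exists2 r, 0 < r & qball rho x r `<=` U].

Definition qborel rho : set (set X) := <<s qopen rho >>.

End QuasiMetric.

Section DyadicCubes.
Context {R : realType} {X : choiceType} {I : int -> choiceType}.
Implicit Types (rho : X -> X -> R) (cube : forall k, I k -> set X)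
  (center : forall k, I k -> X) (k l : int).

(* A cube together with its generation k is an index in I k; the children of
   a cube are therefore indices of generation k + 1. *)
Definition children cube k (a : I k) : set (I (k + 1)) :=
  [set b | cube (k + 1) b `<=` cube k a].

(* fset_set A is the junk value fset0 when A is infinite; dyadic_system
   requires the sets of children to be finite. *)
Definition nchildren cube k (a : I k) : nat := #|` fset_set (children cube a)|.

Definition cube_ball rho (delta C1 : R) center k (a : I k) : set X :=
  qball rho (center k a) (C1 * delta ^ k).

Record dyadic_system rho (delta c1 C1 : R) (M : nat) cube center : Prop := {
  ds_delta : 0 < delta < 1;
  ds_const : 0 < c1 <= C1;
  ds_countable : forall k, countable [set: I k];
  ds_borel : forall k (a : I k), qborel rho (cube k a);
  ds_cover : forall k, \bigcup_(a in [set: I k]) cube k a = [set: X];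
  ds_disjoint : forall k, trivIset [set: I k] (cube k);
  ds_nested : forall k l (a : I k) (b : I l), k <= l ->
    cube l b `<=` cube k a \/ cube k a `&` cube l b = set0;
  ds_ancestor : forall k l (a : I k), l <= k ->
    exists! b : I l, cube k a `<=` cube l b;
  ds_children_cover : forall k (a : I k),
    cube k a = \bigcup_(b in children cube a) cube (k + 1) b;
  ds_children_finite : forall k (a : I k), finite_set (children cube a);
  ds_children_number : forall k (a : I k),
    (1 <= nchildren cube a <= M)%N;
  ds_center : forall k (a : I k), cube k a (center k a);
  ds_inner : forall k (a : I k),
    qball rho (center k a) (c1 * delta ^ k) `<=` cube k a;
  ds_outer : forall k (a : I k),
    cube k a `<=` cube_ball rho delta C1 center a;
  ds_ball_nested : forall k l (a : I k) (b : I l), k <= l ->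
    cube l b `<=` cube k a ->
    cube_ball rho delta C1 center b `<=` cube_ball rho delta C1 center a
}.

Definition distinguished_center center : Prop :=
  exists x0 : X, forall k, exists a : I k, x0 = center k a.

End DyadicCubes.

Section Haar.
Context {R : realType} {d : measure_display} {X : measurableType d}.
Context {I : int -> choiceType}.
Implicit Types (mu : {measure set X -> \bar R}) (rho : X -> X -> R)
  (cube : forall k, I k -> set X)
  (e : forall k, I k -> nat -> I (k + 1)) (k : int) (u j : nat).

(* The child Q_j, 1 <= j <= M_Q, of Q = cube k a is cube (k + 1) (e k a j). *)
Definition child cube e k (a : I k) j : set X := cube (k + 1) (e k a j).

Definition children_indexing mu cube e : Prop :=
  forall k (a : I k),
    set_bij [set j | (1 <= j <= nchildren cube a)%N] (children cube a) (e k a)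
    /\ forall u, (1 <= u <= nchildren cube a)%N ->
       ((1 - (u%:R - 1) / (nchildren cube a)%:R)%:E * mu (cube k a)
          <= \sum_(u <= j < (nchildren cube a).+1) mu (child cube e a j))%E.

Definition tail_union cube e k (a : I k) u : set X :=
  \bigcup_(j in [set j | (u <= j <= nchildren cube a)%N]) child cube e a j.

Definition coef_a mu cube e k (a : I k) u : R :=
  Num.sqrt (fine (mu (tail_union cube e a u.+1))) /
  (Num.sqrt (fine (mu (child cube e a u))) *
   Num.sqrt (fine (mu (tail_union cube e a u)))).

Definition coef_b mu cube e k (a : I k) u : R :=
  Num.sqrt (fine (mu (child cube e a u))) /
  (Num.sqrt (fine (mu (tail_union cube e a u))) *
   Num.sqrt (fine (mu (tail_union cube e a u.+1)))).

(* When mu Q = 0 the formula mu(Q)^(-1/2) 1_Q evaluates to 0, by 0^-1 = 0. *)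
Definition haar mu cube e k (a : I k) u : X -> R :=
  if u is 0%N then
    fun x => (Num.sqrt (fine (mu (cube k a))))^-1 * \1_(cube k a) x
  else if mu (child cube e a u) == 0%E then fun=> 0
  else fun x => coef_a mu cube e a u * \1_(child cube e a u) x
              - coef_b mu cube e a u * \1_(tail_union cube e a u.+1) x.

Definition simple_borel rho (f : X -> R) : Prop :=
  finite_set (range f) /\
  measurable_fun [set: g_sigma_algebraType (qopen rho)]
    (f : g_sigma_algebraType (qopen rho) -> R).

Definition supported_on (A : set X) (f : X -> R) : Prop :=
  forall x, ~ A x -> f x = 0.

Definition constant_on_children cube k (a : I k) (f : X -> R) : Prop :=
  forall b, children cube a b ->
    exists c : R, forall x, cube (k + 1) b x -> f x = c.

(* V(Q); functions on Q are identified with their extensions by zero. *)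
Definition child_constant_functions cube k (a : I k) : set (X -> R) :=
  [set f | supported_on (cube k a) f /\ constant_on_children cube a f].

Definition inner mu (f g : X -> R) : \bar R := (\int[mu]_x (f x * g x)%:E)%E.

Definition not_identically_zero (f : X -> R) : Prop := exists x, f x != 0.

Definition lin_comb (n : nat) (c : nat -> R) (h : nat -> X -> R) : X -> R :=
  fun x => \sum_(0 <= u < n) c u * h u x.

Definition orthogonal_family_in mu (V : set (X -> R)) (n : nat)
    (h : nat -> X -> R) : Prop :=
  (forall u, (u < n)%N -> V (h u)) /\
  (forall u v, (u < n)%N -> (v < n)%N -> u <> v -> inner mu (h u) (h v) = 0%E).

Definition orthogonal_basis mu (V : set (X -> R)) (n : nat)
    (h : nat -> X -> R) : Prop :=
  [/\ orthogonal_family_in mu V n h,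
      forall c, (forall x, lin_comb n c h x = 0) ->
        forall u, (u < n)%N -> c u = 0 &
      forall f, V f -> exists c, forall x, f x = lin_comb n c h x].

(* An orthogonal basis of the image of V in the space of mu-a.e. classes,
   the functions h u that are identically zero being discarded. *)
Definition orthogonal_basis_ae mu (V : set (X -> R)) (n : nat)
    (h : nat -> X -> R) : Prop :=
  [/\ orthogonal_family_in mu V n h,
      forall c, {ae mu, forall x, lin_comb n c h x = 0} ->
        forall u, (u < n)%N -> not_identically_zero (h u) -> c u = 0 &
      forall f, V f -> exists c, {ae mu, forall x, f x = lin_comb n c h x}].

Definition simeq (c : R) (A B : \bar R) : Prop :=
  ((c^-1)%:E * A <= B <= c%:E * A)%E.

Definition exponent_inv (p : \bar R) : R := if p is r%:E then r^-1 else 0.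

Definition Lp_norm mu (p : \bar R) (f : X -> R) : \bar R :=
  Lnorm mu p (EFin \o f).

End Haar.

(* Main.v *)
(* All functions involved are step functions over the children [Q_j] of a cube
   [Q]. For [u < v] the function [h_u] is constant on [E_v], which carries [h_v],
   so orthogonality reduces to cancellation. Since [E_u] is the disjoint union of
   [Q_u] and [E_{u+1}], [h_u] lets one pass from the indicator of [E_u] to that of
   [E_{u+1}], whence the spanning property away from null children. The indexing
   gives [mu E_u >= mu Q / M], so that [|h_u|] is comparable to [mu(Q_u)^(-1/2)]
   on [Q_u], at most a multiple of it elsewhere, and has integral at most
   [2 mu(Q_u)^(1/2)]; interpolating between these bounds gives every L^p norm. *)
Require Import Defs.
From HB Require Import structures.
From mathcomp Require Import all_boot all_order all_algebra.
From mathcomp Require Import finmap.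
From mathcomp Require Import all_classical all_reals all_analysis.
From mathcomp Require Import measurable_realfun ess_sup_inf ring lra zify.

Set Implicit Arguments.
Unset Strict Implicit.
Unset Printing Implicit Defensive.

Import Order.TTheory GRing.Theory Num.Theory.

Local Open Scope classical_set_scope.
Local Open Scope ring_scope.

(** * Integrals and [L^p] norms of step functions *)

Section StepIntegrals.
Context {R : realType} {d : measure_display} {X : measurableType d}.
Context (mu : {measure set X -> \bar R}).
Implicit Types (A B : set X) (f g : X -> R) (c : R).

Lemma integrable_scale_indic A c : measurable A -> (mu A < +oo)%E ->
  mu.-integrable setT (fun x => (c * \1_A x)%:E).
Proof.
move=> mA fA.
have mcA : measurable_fun setT (fun x => c * \1_A x : R).
  by apply: measurable_funM => //; exact: measurable_indic.
apply/integrableP; split; first exact/measurable_EFinP.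
rewrite (eq_integral (fun x => `|c|%:E * (\1_A x)%:E)%E); last first.
  by move=> x _; rewrite /= normrM EFinM (ger0_norm (ler0n _ _)).
rewrite ge0_integralZl //=; last exact/measurable_EFinP.
by rewrite integral_indic // setIT lte_mul_pinfty.
Qed.

Lemma integral_scale_indic A c : measurable A -> (mu A < +oo)%E ->
  (\int[mu]_x (c * \1_A x)%:E = (c * fine (mu A))%:E)%E.
Proof.
move=> mA fA; under eq_integral do rewrite EFinM.
have := integrable_scale_indic 1 mA fA.
under eq_fun do rewrite mul1r.
move=> iA; rewrite integralZl //.
by rewrite integral_indic // setIT EFinM fineK // ge0_fin_numE.
Qed.

Lemma integrable_indicB A B c c' : measurable A -> measurable B ->
  (mu A < +oo)%E -> (mu B < +oo)%E ->
  mu.-integrable setT (fun x => (c * \1_A x - c' * \1_B x)%:E).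
Proof.
move=> mA mB fA fB.
have -> : (fun x => (c * \1_A x - c' * \1_B x)%:E) =
    ((fun x => (c * \1_A x)%:E) \- (fun x => (c' * \1_B x)%:E))%E.
  by apply/funext => x; rewrite /= EFinB.
by apply: integrableB => //; apply: integrable_scale_indic.
Qed.

Lemma integral_indicB A B c c' : measurable A -> measurable B ->
  (mu A < +oo)%E -> (mu B < +oo)%E ->
  (\int[mu]_x (c * \1_A x - c' * \1_B x)%:E
    = (c * fine (mu A) - c' * fine (mu B))%:E)%E.
Proof.
move=> mA mB fA fB; under eq_integral do rewrite EFinB.
rewrite integralB_EFin // ?integral_scale_indic //;
  exact: integrable_scale_indic.
Qed.

(* The three bounds say that [f] behaves like [s^(-1/2) 1_A], [mu A = s]. *)
Lemma Lp_norm_simeq (p : \bar R) f A (s K : R) :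
  measurable_fun setT f -> measurable A -> mu A = s%:E -> 0 < s -> 1 <= K ->
  (forall x, `|f x| <= K * s `^ (- 2^-1)) ->
  (forall x, A x -> K^-1 * s `^ (- 2^-1) <= `|f x|) ->
  (\int[mu]_x `|f x|%:E <= (K * s `^ 2^-1)%:E)%E ->
  (1 <= p)%E ->
  simeq K (Lp_norm mu p f) (s `^ (exponent_inv p - 2^-1))%:E.
Proof.
move=> mf mA muA s0 K1 fub flb f1 p1.
have K0 : 0 < K by exact: lt_le_trans K1.
set w := s `^ (exponent_inv p - 2^-1).
have w0 : 0 <= w by exact: powR_ge0.
(* [simeq] bounds the reference value by multiples of the norm; multiplying through by [K] turns
   this into bounds on the norm itself. *)
suff [lb ub] : ((K^-1 * w)%:E <= Lp_norm mu p f /\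
    Lp_norm mu p f <= (K * w)%:E)%E.
  apply/andP; split.
    rewrite -[w in leRHS](mulKf (lt0r_neq0 K0)) EFinM.
    by rewrite lee_wpmul2l // lee_fin invr_ge0 ltW.
  rewrite -[w in leLHS](mulVKf (lt0r_neq0 K0)) EFinM.
  by rewrite lee_wpmul2l // lee_fin ltW.
have mfn r : measurable_fun setT (fun x => (`|f x| `^ r)%:E).
  apply/measurable_EFinP; apply: (measurableT_comp (measurable_powR r)).
  exact: measurableT_comp.
rewrite /Lp_norm unlock /Lnorm.
case: p p1 @w w0 => [r r1 w w0 |_ w w0|//].
- rewrite lee_fin in r1.
  have r0 : 0 < r by exact: lt_le_trans r1.
  have -> : (\int[mu]_x (`|(EFin \o f) x| `^ r) =
             \int[mu]_x (`|f x| `^ r)%:E)%E by apply: eq_integral.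
  set J := (\int[mu]_x _)%E.
  have wr : w `^ r = s `^ (1 - r / 2).
    by rewrite -powRrM; congr (_ `^ _); rewrite /exponent_inv; field; rewrite gt_eqF.
  have J0 : (0 <= J)%E by apply: integral_ge0 => x _; rewrite lee_fin powR_ge0.
  (* The lower bound integrates over [A] alone: [(K^-1 s^(-1/2))^r s] is [(K^-1 w)^r]. *)
  have lb : (((K^-1 * w) `^ r)%:E <= J)%E.
    have -> : ((K^-1 * w) `^ r)%:E =
        (\int[mu]_x ((K^-1 * s `^ (- 2^-1)) `^ r * \1_A x)%:E)%E.
      rewrite integral_scale_indic ?muA ?ltry //=.
      rewrite !powRM ?powR_ge0 ?invr_ge0 ?(ltW K0) // -mulrA wr; congr (_ * _)%:E.
      rewrite -{3}(powRr1 (ltW s0)) -powRrM -powRD; last by rewrite (gt_eqF s0) implybT.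
      by congr (_ `^ _); field.
    apply: ge0_le_integral => //=.
    + by move=> x _; rewrite lee_fin mulr_ge0 ?powR_ge0.
    + have := integrable_scale_indic ((K^-1 * s `^ (- 2^-1)) `^ r) mA.
      by rewrite muA ltry => /(_ isT) /measurable_int.
    move=> x _; rewrite lee_fin indicE; case: (boolP (x \in A)) => [|_].
      rewrite inE => /flb fx; rewrite mulr1 ge0_ler_powR ?nnegrE ?(ltW r0) //.
      by rewrite mulr_ge0 ?powR_ge0 // invr_ge0 ltW.
    by rewrite mulr0 powR_ge0.
  (* Interpolation: [|f|^r] is at most [(K s^(-1/2))^(r-1) |f|], whose integral the [L^1] bound
     controls. *)
  have ub : (J <= ((K * w) `^ r)%:E)%E.
    apply: (@le_trans _ _
      (\int[mu]_x (((K * s `^ (- 2^-1)) `^ (r - 1))%:E * `|f x|%:E))%E).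
      apply: ge0_le_integral => //=.
      + apply: measurable_funeM; apply/measurable_EFinP; exact: measurableT_comp.
      move=> x _; rewrite -EFinM lee_fin -(mulr_powRB1 (normr_ge0 (f x)) r0) mulrC.
      rewrite ler_wpM2r // ge0_ler_powR ?nnegrE ?subr_ge0 //.
      by rewrite mulr_ge0 ?powR_ge0 ?ltW.
    rewrite ge0_integralZl //=; first last.
    + by rewrite lee_fin powR_ge0.
    + apply/measurable_EFinP; exact: measurableT_comp.
    apply: (le_trans (lee_wpmul2l _ f1)); first by rewrite lee_fin powR_ge0.
    rewrite -EFinM lee_fin !powRM ?powR_ge0 ?(ltW K0) // wr mulrACA.
    rewrite le_eqVlt; apply/orP; left; apply/eqP; congr (_ * _).
      by rewrite mulrC mulr_powRB1 // ltW.
    rewrite -powRrM -powRD; last by rewrite (gt_eqF s0) implybT.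
    by congr (_ `^ _); field.
  have key c : 0 <= c -> c%:E = (((c `^ r)%:E) `^ r^-1)%E.
    by move=> c0; rewrite poweR_EFin -powRrM mulfV ?gt_eqF // powRr1.
  rewrite (key (K^-1 * w)) ?mulr_ge0 ?invr_ge0 ?(ltW K0) //.
  rewrite (key (K * w)) ?mulr_ge0 ?(ltW K0) //.
  split; apply: gt0_ler_poweR => //; rewrite ?invr_ge0 ?(ltW r0) //;
    rewrite ?in_itv /= ?leey ?andbT ?lee_fin ?powR_ge0 //.
(* The [L^oo] norm is an essential supremum only on a space of positive measure, which [A]
   provides. *)
- have T0 : (0 < mu setT)%E.
    by apply: (@lt_le_trans _ _ (mu A)); rewrite ?muA ?lte_fin // -muA le_measure ?inE.
  rewrite T0; have wE : w = s `^ (- 2^-1) by rewrite /w /exponent_inv add0r.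
  rewrite wE; split; last by apply/ess_supP/nearW => x /=; rewrite lee_fin.
  (* If the claimed bound failed, [|f|] would exceed its essential supremum on all of [A], and [A]
     would lie in a null set. *)
  rewrite leNgt; apply/negP => lt_sup.
  have [N [mN N0 sN]] := ess_sup_ge mu (abse \o (EFin \o f)).
  have : (mu A <= mu N)%E.
    rewrite le_measure ?inE // => x Ax; apply: sN => /= fx.
    have := le_lt_trans fx lt_sup; rewrite lte_fin ltNge => /negP; apply.
    exact: flb.
  by rewrite N0 muA lee_fin leNgt s0.
Qed.
End StepIntegrals.

(** * Children and tail unions of a fixed cube [Q], and their measures *)

Section Haar.
Context {R : realType} {d : measure_display} {X : measurableType d}.
Context {I : int -> choiceType}.
Context {mu : {measure set X -> \bar R}} {cube : forall k, I k -> set X}.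
Context {e : forall k, I k -> nat -> I (k + 1)}.
Context (mcube : forall k (a : I k), measurable (cube a)).
Context (fcube : forall k (a : I k), (mu (cube a) < +oo)%E).
Context (dcube : forall k, trivIset [set: I k] (cube (k := k))).
Context (cover_children : forall k (a : I k),
  cube a = \bigcup_(b in children cube a) cube b).
Context (he : children_indexing mu cube e).
Context (k : int) (a : I k).

Local Notation N := (nchildren cube a).
Local Notation Q := (cube a).
Local Notation q := (child cube e a).
Local Notation E := (tail_union cube e a).
Local Notation h := (haar mu cube e a).
Local Notation m A := (fine (mu A)).

Lemma child_sub j : (1 <= j <= N)%N -> q j `<=` Q.
Proof. by move=> jN; have [[/(_ j jN)]] := he a. Qed.

Lemma childP x : Q x -> exists2 j, (1 <= j <= N)%N & q j x.
Proof.
rewrite cover_children => -[b bQ bx].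
have [[_ _ /(_ b bQ)[j jN ejb]] _] := he a.
by exists j => //; rewrite /child ejb.
Qed.

Lemma child_inj i j x : (1 <= i <= N)%N -> (1 <= j <= N)%N ->
  q i x -> q j x -> i = j.
Proof.
move=> iN jN qi qj; have [[_ inj _] _] := he a.
apply: inj; rewrite ?inE //.
by apply: (dcube (k := k + 1)) => //; exists x.
Qed.

Lemma tail_union_sub u v : (u <= v)%N -> E v `<=` E u.
Proof.
by move=> uv x [j /= /andP[vj jN] qx]; exists j => //=; rewrite jN (leq_trans uv).
Qed.

Lemma tail_union_rec u : (u <= N)%N -> E u = q u `|` E u.+1.
Proof.
move=> uN; apply/seteqP; split=> [x [j /= /andP[]]|x [qx|]].
- rewrite leq_eqVlt => /orP[/eqP<- _ qx|uj jN qx]; first by left.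
  by right; exists j => //=; rewrite uj.
- by exists u => //=; rewrite leqnn.
- exact: tail_union_sub.
Qed.

Lemma tail_union1 : E 1 = Q.
Proof.
apply/seteqP; split=> [x [j /= jN]|x Qx]; first exact: child_sub.
by have [j jN qx] := childP Qx; exists j.
Qed.

Lemma tail_union_last : E N.+1 = set0.
Proof. by apply/seteqP; split=> x // [j /= jN _]; move: jN; lia. Qed.

Lemma child_tail_disjoint u : (1 <= u <= N)%N -> q u `&` E u.+1 = set0.
Proof.
move=> uN; apply/seteqP; split=> x // [qx [j /= jN qjx]].
have : u = j by apply: (child_inj (x := x)) => //; lia.
lia.
Qed.

Lemma child_notin_tail u x : (1 <= u <= N)%N -> q u x -> ~ E u.+1 x.
Proof.
move=> uN qx Ex; have : (q u `&` E u.+1) x by [].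
by rewrite child_tail_disjoint.
Qed.

Lemma measurable_tail_union u : measurable (E u).
Proof. by apply: bigcup_measurable => j _; exact: mcube. Qed.

Lemma tail_union_sub_cube u : (1 <= u)%N -> E u `<=` Q.
Proof. by rewrite -tail_union1; exact: tail_union_sub. Qed.

Lemma tail_union_finite u : (1 <= u)%N -> (mu (E u) < +oo)%E.
Proof.
move=> u1; apply: le_lt_trans (fcube a).
rewrite le_measure ?inE //; first exact: measurable_tail_union.
exact: tail_union_sub_cube.
Qed.

Lemma measure_tail_union u : (1 <= u <= N)%N -> mu (E u) = (mu (q u) + mu (E u.+1))%E.
Proof.
move=> uN; rewrite tail_union_rec; last by lia.
rewrite measureU //; [exact: mcube|exact: measurable_tail_union|].
exact: child_tail_disjoint.
Qed.

(** Downward induction from the empty tail [E N.+1]. The indexing hypothesis speaks of this sum, and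
    the lemma turns it into a bound on [mu (E u)]. *)
Lemma measure_tail_union_sum u : (1 <= u <= N.+1)%N ->
  mu (E u) = (\sum_(u <= j < N.+1) mu (q j))%E.
Proof.
move=> uN; have [n un] : exists n, (u + n = N.+1)%N by exists (N.+1 - u)%N; lia.
elim: n u uN un => [|n IHn] u uN un.
  by rewrite addn0 in un; rewrite un tail_union_last measure0 big_geq.
have [u1 uN'] : (1 <= u <= N)%N /\ (1 <= u.+1 <= N.+1)%N by move: uN un; lia.
rewrite measure_tail_union // [RHS]big_ltn; last by case/andP: u1.
by rewrite (IHn u.+1) // addSnnS.
Qed.

Lemma fine_tail_union u : (1 <= u <= N)%N -> m (E u) = m (q u) + m (E u.+1).
Proof.
move=> uN; rewrite measure_tail_union // fineD //; rewrite ge0_fin_numE //.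
  exact: fcube.
by apply: tail_union_finite.
Qed.

(* [1 - (u - 1)/N >= 1/N] for [u <= N]. *)
Lemma le_measure_tail u : (1 <= u <= N)%N -> m Q <= N%:R * m (E u).
Proof.
move=> uN; have [_ /(_ u uN)] := he a.
rewrite -measure_tail_union_sum; last by lia.
rewrite -[mu Q]fineK ?ge0_fin_numE ?fcube // -[mu (E u)]fineK; last first.
  by rewrite ge0_fin_numE // tail_union_finite //; lia.
rewrite -EFinM lee_fin => le_tail.
have N0 : 0 < N%:R :> R by rewrite ltr0n; lia.
rewrite mulrC -ler_pdivrMr //; apply: le_trans le_tail.
rewrite mulrC ler_wpM2r ?fine_ge0 //.
have : (u%:R : R) <= N%:R by rewrite ler_nat; lia.
move: N0; set n : R := N%:R; set t : R := u%:R => n0 tn.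
by rewrite -(ler_pM2r n0) mulrBl mulfVK ?mulVf ?gt_eqF // mul1r; lra.
Qed.

(** * Haar functions on the children: values, support, constancy *)

Definition child_value u j : R :=
  if u is 0%N then (Num.sqrt (m Q))^-1
  else coef_a mu cube e a u * (j == u)%:R - coef_b mu cube e a u * (u < j)%:R.

(* If [mu (q u) = 0], both coefficients vanish, as [0^-1 = 0]. *)
Lemma haarE u x : (0 < u)%N -> h u x =
  coef_a mu cube e a u * \1_(q u) x - coef_b mu cube e a u * \1_(E u.+1) x.
Proof.
case: u => // u _; rewrite /haar; case: eqP => // q0.
by rewrite /coef_a /coef_b q0 /= sqrtr0 !mul0r invr0 mulr0 !mul0r subr0.
Qed.

Lemma indic_tail u j x : (1 <= j <= N)%N -> (1 <= u)%N -> q j x ->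
  \1_(E u) x = (u <= j)%:R :> R.
Proof.
move=> jN u1 qx; rewrite indicE; congr (_%:R); congr nat_of_bool.
apply/idP/idP => [|uj]; rewrite inE.
  move=> [i /= iN qix]; have -> : j = i by apply: (child_inj (x := x)) => //; lia.
  lia.
by exists j => //=; lia.
Qed.

Lemma indic_child u j x : (1 <= j <= N)%N -> (1 <= u <= N)%N -> q j x ->
  \1_(q u) x = (j == u)%:R :> R.
Proof.
move=> jN uN qx; rewrite indicE; congr (_%:R); congr nat_of_bool.
apply/idP/eqP => [|<-]; rewrite inE // => qux.
exact: (child_inj (x := x)).
Qed.

(** Pointwise claims about [h u] thereby become comparisons of the indices [u] and [j]. *)
Lemma haar_child u j x : (u < N)%N -> (1 <= j <= N)%N -> q j x ->
  h u x = child_value u j.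
Proof.
move=> uN jN qx; case: u uN => [|u] uN.
  by rewrite /haar indicE mem_set ?mulr1 //; exact: (child_sub jN).
by rewrite haarE // (indic_tail (j := j)) // (indic_child (j := j)) //; lia.
Qed.

Lemma haar_supported u : (u < N)%N -> supported_on Q (h u).
Proof.
move=> uN x Qx; case: u uN => [|u] uN.
  by rewrite /haar indicE memNset ?mulr0.
rewrite haarE // !indicE !memNset ?mulr0 ?subr0 // => [/tail_union_sub_cube|/child_sub] qx.
  by apply/Qx/qx.
by apply/Qx/qx; lia.
Qed.

Lemma haar_constant u : (u < N)%N -> constant_on_children cube a (h u).
Proof.
move=> uN b bQ; have [[_ _ /(_ b bQ)[j jN <-]] _] := he a.
by exists (child_value u j) => x qx; exact: haar_child.
Qed.

(** * Cancellation and orthogonality *)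

(** Both sides are the square root of [mu (q u) * mu (E u.+1) / mu (E u)] when these measures are
    positive; otherwise both vanish under the convention [0^-1 = 0]. *)
Lemma coef_balance u : (1 <= u)%N ->
  coef_a mu cube e a u * m (q u) = coef_b mu cube e a u * m (E u.+1).
Proof.
move=> u1; rewrite /coef_a /coef_b.
rewrite -{2}(sqr_sqrtr (fine_ge0 (measure_ge0 mu (q u)))).
rewrite -{3}(sqr_sqrtr (fine_ge0 (measure_ge0 mu (E u.+1)))).
set x := Num.sqrt _; set y := Num.sqrt _; set z := Num.sqrt _.
have [->|x0] := eqVneq x 0; first by rewrite expr0n !(mulr0, mul0r).
have [->|y0] := eqVneq y 0; first by rewrite expr0n !(mulr0, mul0r).
have [->|z0] := eqVneq z 0; first by rewrite !(invr0, mulr0, mul0r).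
by field; rewrite x0 y0 z0.
Qed.

Lemma integrable_haar u : mu.-integrable setT (EFin \o h u).
Proof.
case: u => [|u]; first exact: integrable_scale_indic.
have -> : EFin \o h u.+1 = (fun x => (coef_a mu cube e a u.+1 * \1_(q u.+1) x
    - coef_b mu cube e a u.+1 * \1_(E u.+2) x)%:E).
  by apply/funext => x; rewrite /= -haarE.
by apply: integrable_indicB; [exact: mcube|exact: measurable_tail_union
  |exact: fcube|exact: tail_union_finite].
Qed.

Lemma integral_haar u : (1 <= u)%N -> (\int[mu]_x (h u x)%:E = 0)%E.
Proof.
move=> u1; under eq_integral do rewrite haarE //.
rewrite integral_indicB; [|exact: mcube|exact: measurable_tail_union
  |exact: fcube|exact: tail_union_finite].
by rewrite coef_balance // subrr.
Qed.

(* [h u] is constant on [E u.+1], which carries [h v] for [u < v]. *)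
Lemma haar_mul u v x : (u < v < N)%N ->
  h u x * h v x = child_value u u.+1 * h v x.
Proof.
move=> /andP[uv vN]; have [Qx|Qx] := pselect (Q x); last first.
  by rewrite (haar_supported vN Qx) !mulr0.
have [j jN qx] := childP Qx.
rewrite !(haar_child _ jN qx) //; last exact: ltn_trans vN.
(* Before child [v] the function [h v] vanishes; from [v] on, [j > u], so [h u] has the value it
   takes on child [u.+1]. *)
have [jv|vj] := ltnP j v.
  case: v jv {uv vN} => // v jv; rewrite [child_value v.+1 j]/child_value.
  by rewrite ltn_eqF // ltnNge ltnW // !mulr0 subrr !mulr0.
congr (_ * _); case: u uv => // u uv; rewrite /child_value.
have -> : (j == u.+1) = false by apply/eqP; lia.
have -> : (u.+1 < j)%N by lia.
by rewrite ltnSn gtn_eqF.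
Qed.

Lemma haar_orthogonal u v : (u < N)%N -> (v < N)%N -> u <> v ->
  inner mu (h u) (h v) = 0%E.
Proof.
have wlog_lt i j : (i < j < N)%N -> inner mu (h i) (h j) = 0%E.
  move=> ijN; rewrite /inner.
  under eq_integral do rewrite haar_mul // EFinM.
  rewrite integralZl //; last exact: integrable_haar.
  by rewrite integral_haar ?mule0 //; lia.
move=> uN vN uv; have [lt_uv|lt_vu|//] := ltngtP u v.
  by rewrite wlog_lt // lt_uv.
rewrite -(wlog_lt v u) ?lt_vu // /inner.
by under eq_integral do rewrite mulrC.
Qed.

(** * Simplicity and Borel measurability *)

Lemma haar_simple (rho : X -> X -> R) u :
  (forall k (a : I k), qborel rho (cube a)) -> simple_borel rho (h u).
Proof.
move=> bcube.
(* Borel measurability refers to the sigma-algebra generated by [qopen rho], possibly smaller than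
   that of [X], so the functions are viewed on [Y]. *)
pose Y := g_sigma_algebraType (qopen rho).
have mE v : measurable (E v : set Y) by apply: bigcup_measurable => j _; exact: bcube.
have mI (A : set Y) c : measurable A -> measurable_fun [set: Y] (fun x => c * \1_A x : R).
  by move=> mA; apply: measurable_funM => //; exact: measurable_indic.
case: u => [|u].
  split; last by apply: mI; exact: bcube.
  apply: (@sub_finite_set _ _ [set 0; (Num.sqrt (m Q))^-1]) => [_ [x _ <-]|].
    by rewrite /= /haar indicE; case: (x \in Q); rewrite ?mulr1 ?mulr0; [right|left].
  exact: finite_set2.
have -> : h u.+1 = (fun x => coef_a mu cube e a u.+1 * \1_(q u.+1) x
    - coef_b mu cube e a u.+1 * \1_(E u.+2) x).
  by apply/funext => x; rewrite haarE.
split; last by apply: measurable_funB; apply: mI; [exact: bcube|exact: mE].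
set c := coef_a _ _ _ _ _; set c' := coef_b _ _ _ _ _.
(* One value for each pair of values of the two indicators. *)
apply: (@sub_finite_set _ _ ([set 0; c] `|` [set - c'; c - c'])).
  move=> _ [x _ <-] /=; rewrite !indicE.
  case: (x \in _); case: (x \in _); rewrite ?mulr1 ?mulr0 ?subr0 ?sub0r ?subrr; tauto.
by rewrite finite_setU; split; exact: finite_set2.
Qed.

(** * Positivity and [L^2] normalisation *)

(** One non-null child makes [Q] non-null, and the indexing bound then gives positive measure to
    every tail, even to those beyond [u]. *)
Lemma measure_tail_gt0 u v : (1 <= u <= N)%N -> 0 < m (q u) ->
  (1 <= v <= N)%N -> 0 < m (E v).
Proof.
move=> uN qu vN.
have Q0 : 0 < m Q.
  apply: lt_le_trans qu _; rewrite fine_le ?ge0_fin_numE ?fcube //.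
  by apply: le_measure; rewrite ?inE; [exact: mcube|exact: mcube|exact: child_sub].
have := lt_le_trans Q0 (le_measure_tail vN).
by rewrite pmulr_rgt0 // ltr0n; lia.
Qed.

Lemma haar0_neq0 : not_identically_zero (h 0) -> 0 < m Q.
Proof.
case=> x; rewrite /haar lt_def fine_ge0 // andbT; apply: contraNN => /eqP ->.
by rewrite sqrtr0 invr0 mul0r.
Qed.

Lemma haar_neq0 u : (1 <= u)%N -> not_identically_zero (h u) -> 0 < m (q u).
Proof.
move=> u1 [x]; rewrite haarE // lt_def fine_ge0 // andbT; apply: contraNN => /eqP q0.
by rewrite /coef_a /coef_b q0 sqrtr0 !mul0r invr0 mulr0 !mul0r subrr.
Qed.

Lemma coef_sum_gt0 u : (1 <= u < N)%N -> 0 < m (q u) ->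
  0 < coef_a mu cube e a u + coef_b mu cube e a u.
Proof.
move=> uN q0.
have y0 : 0 < m (E u.+1) by apply: (measure_tail_gt0 _ q0); lia.
have z0 : 0 < m (E u) by apply: (measure_tail_gt0 _ q0); lia.
by apply: addr_gt0; rewrite divr_gt0 ?mulr_gt0 ?sqrtr_gt0.
Qed.

(** This is the squared [L^2] norm of [h u]: the terms are [mu (E u.+1) / mu (E u)] and
    [mu (q u) / mu (E u)], which add up to 1 by additivity. *)
Lemma coef_sqr_norm u : (1 <= u < N)%N -> 0 < m (q u) ->
  coef_a mu cube e a u ^+ 2 * m (q u) + coef_b mu cube e a u ^+ 2 * m (E u.+1) = 1.
Proof.
move=> uN q0.
have y0 : 0 < m (E u.+1) by apply: (measure_tail_gt0 _ q0); lia.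
have zE : m (E u) = m (q u) + m (E u.+1) by apply: fine_tail_union; lia.
rewrite /coef_a /coef_b !expr_div_n !exprMn !sqr_sqrtr ?fine_ge0 // zE.
by field; rewrite !gt_eqF // addr_gt0.
Qed.

(** The cross term vanishes because [q u] and [E u.+1] are disjoint; the double sign matches the
    form of [integral_indicB]. *)
Lemma haar_sqr u x : (1 <= u < N)%N -> h u x * h u x =
  coef_a mu cube e a u ^+ 2 * \1_(q u) x - (- coef_b mu cube e a u ^+ 2) * \1_(E u.+1) x.
Proof.
move=> uN; rewrite haarE; last by lia.
have [qx|qx] := pselect (q u x).
  have nEx : ~ E u.+1 x by apply: (child_notin_tail _ qx); lia.
  by rewrite !indicE (mem_set qx) (memNset nEx) /=; ring.
by rewrite !indicE (memNset qx); case: (x \in _) => /=; ring.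
Qed.

Lemma integrable_haarM u v : (u < N)%N -> (v < N)%N ->
  mu.-integrable setT (fun x => (h u x * h v x)%:E).
Proof.
have wlog_lt i j : (i < j < N)%N -> mu.-integrable setT (fun x => (h i x * h j x)%:E).
  move=> ijN.
  have -> : (fun x => (h i x * h j x)%:E) =
      (fun x => (child_value i i.+1)%:E * (EFin \o h j) x)%E.
    by apply/funext => x; rewrite haar_mul // EFinM.
  by apply: integrableZl => //; exact: integrable_haar.
move=> uN vN; have [lt_uv|lt_vu|<-] := ltngtP u v.
- by apply: wlog_lt; rewrite lt_uv.
- under eq_fun do rewrite mulrC.
  by apply: wlog_lt; rewrite lt_vu.
case: u uN => [|u] uN.
  have -> : (fun x => (h 0 x * h 0 x)%:E) =
      (fun x => ((Num.sqrt (m Q))^-1 ^+ 2 * \1_Q x)%:E).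
    apply/funext => x; rewrite /haar indicE.
    by case: (x \in Q); rewrite ?mulr1 ?mulr0 ?expr2.
  exact: integrable_scale_indic.
under eq_fun do rewrite haar_sqr //.
by apply: integrable_indicB; [exact: mcube|exact: measurable_tail_union
  |exact: fcube|exact: tail_union_finite].
Qed.

Lemma haar_unit_norm u : (u < N)%N -> not_identically_zero (h u) ->
  inner mu (h u) (h u) = 1%E.
Proof.
case: u => [|u] uN hu.
  rewrite /inner; under eq_integral => x _.
    rewrite (_ : _ * _ = (m Q)^-1 * \1_Q x); last first.
      rewrite /haar indicE; case: (x \in Q); rewrite ?mulr1 ?mulr0 //.
      by rewrite -expr2 exprVn sqr_sqrtr ?fine_ge0.
    over.
  by rewrite integral_scale_indic // mulVf // gt_eqF // haar0_neq0.
rewrite /inner; under eq_integral do rewrite haar_sqr //.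
rewrite integral_indicB; [|exact: mcube|exact: measurable_tail_union
  |exact: fcube|exact: tail_union_finite].
by rewrite mulNr opprK coef_sqr_norm //; exact: haar_neq0.
Qed.

(** * Linear independence almost everywhere *)

(** Integrating the combination against [h v] isolates [c v], by orthogonality and the unit norm of
    [h v]. *)
Lemma haar_free_ae (c : nat -> R) :
  {ae mu, forall x, lin_comb N c h x = 0} ->
  forall u, (u < N)%N -> not_identically_zero (h u) -> c u = 0.
Proof.
move=> c0 v vN hv.
have iM u : (u < N)%N -> mu.-integrable setT (fun x => (c u)%:E * (h u x * h v x)%:E)%E.
  by move=> uN; apply: integrableZl => //; exact: integrable_haarM.
(* Extended by zero past [N], so that integrability holds for every index when sum and integral are
   interchanged. *)
pose F u := if (u < N)%N then (fun x => (c u)%:E * (h u x * h v x)%:E)%E else cst 0%E.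
have iF u : mu.-integrable setT (F u).
  by rewrite /F; case: ifPn => [/iM //|_]; exact: integrable0.
have sumE x : (\sum_(0 <= u < N) F u x)%E = (lin_comb N c h x * h v x)%:E.
  rewrite /lin_comb mulr_suml -sumEFin !big_nat; apply: eq_bigr => u /andP[_ uN].
  by rewrite /F uN -EFinM mulrA.
have : (\int[mu]_x \sum_(0 <= u < N) F u x = 0)%E.
  rewrite -[RHS](integral0 mu setT); apply: ae_eq_integral => //.
  - by apply: emeasurable_sum => u; exact: measurable_int (iF u).
  - by apply: filterS c0 => x cx _; rewrite sumE cx mul0r.
rewrite integral_sum // (bigD1_seq v) ?iota_uniq ?mem_index_iota //=.
rewrite big_nat_cond big1_seq ?adde0; last first.
  move=> u; rewrite mem_index_iota => /andP[/andP[/andP[_ uN] uv] _].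
  rewrite /F uN integralZl //; last exact: integrable_haarM.
  rewrite (_ : (\int[mu]_x _)%E = inner mu (h u) (h v)) //.
  by rewrite haar_orthogonal ?mule0 //; exact/eqP.
rewrite /F vN integralZl //; last exact: integrable_haarM.
rewrite (_ : (\int[mu]_x _)%E = inner mu (h v) (h v)) //.
by rewrite haar_unit_norm // mule1 => -[].
Qed.

(** * Spanning of [V(Q)] away from the null children *)

(** A single exceptional set for all functions; it is empty when every child has positive
    measure. *)
Let null_children : set X :=
  \bigcup_j (if (1 <= j <= N)%N && (m (q j) == 0) then q j else set0).

Let null_childrenP x j : (1 <= j <= N)%N -> q j x -> ~ null_children x ->
  0 < m (q j).
Proof.
move=> jN qx; rewrite lt_def fine_ge0 // andbT => Zx; apply/negP => qj0.
by apply: Zx; exists j => //; rewrite jN qj0.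
Qed.

Let negligible_null_children : mu.-negligible null_children.
Proof.
apply: negligible_bigcup => j; case: ifPn => [/andP[_ /eqP q0]|_]; last exact: negligible_set0.
apply/negligibleP; first exact: mcube.
by rewrite -[LHS]fineK ?ge0_fin_numE ?fcube // q0.
Qed.

(** Equality at every point off one fixed set serves the pointwise basis as well as the almost
    everywhere one. *)
Let spanned (f : X -> R) :=
  exists c, forall x, ~ null_children x -> f x = lin_comb N c h x.

Let spanned_ext f g : (forall x, ~ null_children x -> f x = g x) ->
  spanned g -> spanned f.
Proof. by move=> fg [c gc]; exists c => x Zx; rewrite fg ?gc. Qed.

Let spanned_haar u : (u < N)%N -> spanned (h u).
Proof.
move=> uN; exists (fun v => (v == u)%:R) => x _.
rewrite /lin_comb (bigD1_seq u) ?iota_uniq ?mem_index_iota //= eqxx mul1r.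
by rewrite big1 ?addr0 // => v /negPf ->; rewrite mul0r.
Qed.

Let spannedD c c' f g : spanned f -> spanned g ->
  spanned (fun x => c * f x + c' * g x).
Proof.
move=> [s fs] [t gt]; exists (fun u => c * s u + c' * t u) => x Zx.
rewrite fs // gt // /lin_comb !mulr_sumr -big_split /=.
by apply: eq_bigr => u _; rewrite mulrDl !mulrA.
Qed.

Let spanned0 : spanned (fun=> 0).
Proof. by exists (fun=> 0) => x _; rewrite /lin_comb big1 // => u _; rewrite mul0r. Qed.

(** Induction on [u], starting from [h 0], a multiple of the indicator of [Q], and ending at the
    empty tail [E N.+1]. *)
Let spanned_tail u : (1 <= u <= N.+1)%N -> spanned \1_(E u).
Proof.
elim: u => // u IHu uN.
have [uN'|uN'] := ltnP u N; last first.
  have -> : u = N by lia.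
  by rewrite tail_union_last indic0; exact: spanned0.
case: u IHu uN uN' => [|u] IHu uN uN'.
  rewrite tail_union1; apply: spanned_ext (spannedD (Num.sqrt (m Q)) 0 (spanned_haar uN') spanned0).
  move=> x Zx; rewrite mulr0 addr0 /haar.
  have [Qx|Qx] := pselect (Q x); last by rewrite indicE memNset // !mulr0.
  have [j jN qx] := childP Qx.
  (* A point of [Q] off [null_children] lies in a non-null child; hence [mu Q > 0] and [h 0] can be
     rescaled. *)
  have qj0 := null_childrenP jN qx Zx.
  have Q0 : 0 < m Q by rewrite -tail_union1 (measure_tail_gt0 jN qj0) //; lia.
  by rewrite mulVKf // gt_eqF // sqrtr_gt0.
have {IHu} sE : spanned \1_(E u.+1) by apply: IHu; lia.
have tailU x : \1_(E u.+1) x = \1_(q u.+1) x + \1_(E u.+2) x :> R.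
  rewrite !indicE (tail_union_rec (u := u.+1)); last by lia.
  have [qx|qx] := pselect (q u.+1 x).
    have nEx : ~ E u.+2 x by apply: (child_notin_tail _ qx); lia.
    by rewrite (mem_set qx) (memNset nEx) mem_set ?addr0 //; left.
  by rewrite in_setU (memNset qx) add0r.
(* If the child is null, the two consecutive tails agree off [null_children]. *)
have [q0|q0] := eqVneq (m (q u.+1)) 0.
  apply: spanned_ext sE => x Zx; rewrite tailU !indicE (memNset (A := q u.+1)) ?add0r // => qx.
  have uN1 : (1 <= u.+1 <= N)%N by lia.
  by have := null_childrenP uN1 qx Zx; rewrite q0 ltxx.
have ab0 : 0 < coef_a mu cube e a u.+1 + coef_b mu cube e a u.+1.
  by apply: coef_sum_gt0 => //; rewrite lt_def q0 fine_ge0.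
set s := coef_a _ _ _ _ _ + _ in ab0.
(* Solves [h u.+1 = a 1_(E u.+1) - (a + b) 1_(E u.+2)] for the second indicator, with
   [s = a + b > 0]. *)
apply: spanned_ext (spannedD (coef_a mu cube e a u.+1 / s) (- s^-1) sE (spanned_haar uN')).
move=> x _; rewrite tailU haarE //.
by rewrite /s; field; rewrite -/s gt_eqF.
Qed.

(** A child is the difference of two consecutive tails. *)
Let spanned_child j : (1 <= j <= N)%N -> spanned \1_(q j).
Proof.
move=> jN.
have sj : spanned \1_(E j) by apply: spanned_tail; lia.
have sj1 : spanned \1_(E j.+1) by apply: spanned_tail; lia.
apply: spanned_ext (spannedD 1 (-1) sj sj1) => x _.
rewrite mul1r mulN1r !indicE (tail_union_rec (u := j)); last by lia.
have [qx|qx] := pselect (q j x); last by rewrite in_setU (memNset qx) subrr.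
have nEx : ~ E j.+1 x by exact: (child_notin_tail jN qx).
by rewrite (mem_set qx) (memNset nEx) mem_set ?subr0 //; left.
Qed.

Let spanned_child_constant f : child_constant_functions cube a f -> spanned f.
Proof.
move=> [fQ fc].
have /choice[v fv] : forall j, exists c, (1 <= j <= N)%N -> forall x, q j x -> f x = c.
  move=> j; have [jN|jN] := boolP (1 <= j <= N)%N; last by exists 0.
  by have [c fqc] := fc _ (child_sub jN); exists c.
have sn n : (n <= N)%N -> spanned (fun x => \sum_(1 <= j < n.+1) v j * \1_(q j) x).
  elim: n => [|n IHn] nN.
    by apply: spanned_ext spanned0 => x _; rewrite big_geq.
  have qn : spanned \1_(q n.+1) by exact: spanned_child.
  apply: spanned_ext (spannedD 1 (v n.+1) (IHn (ltnW nN)) qn) => x _.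
  by rewrite big_nat_recr //= mul1r.
apply: spanned_ext (sn N (leqnn _)) => x _.
have [Qx|Qx] := pselect (Q x); last first.
  rewrite fQ // big_nat big1 // => j jN; rewrite indicE memNset ?mulr0 // => /child_sub qx.
  exact/Qx/qx.
have [j jN qx] := childP Qx.
rewrite (bigD1_seq j) ?iota_uniq ?mem_index_iota //= indicE mem_set // mulr1.
rewrite (fv j jN x qx) big_nat_cond big1 ?addr0 // => i /andP[iN ij].
rewrite indicE memNset ?mulr0 // => qix.
by move/eqP: ij; apply; exact: (child_inj (x := x)).
Qed.

(** * Orthogonal bases of [V(Q)], almost everywhere and pointwise *)

Lemma haar_orthogonal_family :
  orthogonal_family_in mu (child_constant_functions cube a) N h.
Proof.
split=> [u uN|u v]; last exact: haar_orthogonal.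
by split; [exact: haar_supported|exact: haar_constant].
Qed.

Lemma haar_basis_ae :
  orthogonal_basis_ae mu (child_constant_functions cube a) N h.
Proof.
split; [exact: haar_orthogonal_family|exact: haar_free_ae|].
move=> f /spanned_child_constant[c fc]; exists c.
apply: negligibleS negligible_null_children => x /= fx.
by apply: contra_notP fx => /fc.
Qed.

(** Positive measures leave [null_children] empty and keep every [h u] from vanishing identically,
    so the almost everywhere arguments become pointwise. *)
Lemma haar_basis : (forall b, children cube a b -> (0 < mu (cube b))%E) ->
  orthogonal_basis mu (child_constant_functions cube a) N h.
Proof.
move=> pos.
have qpos j : (1 <= j <= N)%N -> 0 < m (q j).
  by move=> jN; rewrite fine_gt0 // fcube andbT pos //; exact: child_sub.
have qne j : (1 <= j <= N)%N -> exists x, q j x.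
  move=> jN; apply/set0P/negP => /eqP q0.
  by have := qpos j jN; rewrite q0 measure0 ltxx.
split; [exact: haar_orthogonal_family| |].
  move=> c c0 u uN; apply: haar_free_ae (uN) _; first exact/nearW.
  (* Nonvanishing is witnessed on child 1 for [h 0], and on child [u] for [h u] with [u >= 1], where
     the value is [a_u > 0]. *)
  case: u uN => [|u] uN.
    have [x qx] := qne 1%N ltac:(lia); exists x.
    rewrite (haar_child _ _ qx) //= invr_neq0 // sqrtr_eq0 -ltNge.
    have N1 : (1 <= 1 <= N)%N by lia.
    by rewrite -tail_union1; exact: (measure_tail_gt0 N1 (qpos _ N1)).
  have uN1 : (1 <= u.+1 <= N)%N by lia.
  have [x qx] := qne _ uN1; exists x.
  rewrite (haar_child _ _ qx) //= eqxx ltnn mulr1 mulr0 subr0 gt_eqF //.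
  have y0 : 0 < m (E u.+2) by apply: (measure_tail_gt0 uN1 (qpos _ uN1)); lia.
  have z0 : 0 < m (E u.+1) by exact: (measure_tail_gt0 uN1 (qpos _ uN1)).
  by rewrite divr_gt0 ?mulr_gt0 ?sqrtr_gt0 // qpos.
move=> f /spanned_child_constant[c fc]; exists c => x; apply: fc.
move=> [j _]; case: ifPn => // /andP[jN /eqP q0].
by have := qpos j jN; rewrite q0 ltxx.
Qed.

(** * Size of the coefficients and [L^p] norms *)

(* With [s ^+ 2 = mu (q u)], [t ^+ 2 = mu (E u.+1)] and [r ^+ 2 = mu (E u)]. *)
Let real_coef_bounds (s t r K : R) : 0 < s -> 0 < t -> 0 < r -> 1 <= K ->
  r ^+ 2 = s ^+ 2 + t ^+ 2 -> r ^+ 2 <= K * t ^+ 2 ->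
  [/\ K^-1 * s^-1 <= t / (s * r), t / (s * r) <= K * s^-1,
      s / (r * t) <= K * s^-1 & t / (s * r) * s ^+ 2 <= s].
Proof.
move=> s0 t0 r0 K1 rE rK.
have K0 : 0 < K by exact: lt_le_trans K1.
have sqr_le (x y : R) : 0 < x -> 0 < y -> x ^+ 2 <= y ^+ 2 -> x <= y.
  by move=> x0 y0; rewrite ler_pXn2r // nnegrE ltW.
have sr : s <= r by apply: sqr_le => //; rewrite rE lerDl sqr_ge0.
have tr : t <= r by apply: sqr_le => //; rewrite rE lerDr sqr_ge0.
(* [r^2 <= K t^2 <= (K t)^2], as [K >= 1]. *)
have rt : r <= K * t.
  apply: sqr_le; rewrite ?mulr_gt0 // exprMn; apply: le_trans rK _.
  by rewrite ler_wpM2r ?sqr_ge0 // expr2 ler_peMl // (ltW K0).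
have sr0 : 0 < s * r by rewrite mulr_gt0.
split.
- rewrite ler_pdivlMr //.
  have -> : K^-1 * s^-1 * (s * r) = K^-1 * r by field; rewrite !gt_eqF.
  by rewrite ler_pdivrMl.
- rewrite ler_pdivrMr //.
  have -> : K * s^-1 * (s * r) = K * r by field; rewrite gt_eqF.
  by apply: le_trans tr _; rewrite ler_peMl // (ltW r0).
- rewrite ler_pdivrMr ?mulr_gt0 // mulrAC ler_pdivlMr //.
  rewrite [K * _]mulrCA; apply: ler_pM => //; try exact: ltW.
  exact: le_trans rt.
- have -> : t / (s * r) * s ^+ 2 = s * (t / r) by field; rewrite !gt_eqF.
  by rewrite ger_pMr // ler_pdivrMr // mul1r.
Qed.

(** [K] is any bound on the number of children, so that one constant can serve all cubes. As
    [u.+1 <= N], the indexing gives [mu (E u) <= mu Q <= K mu (E u.+1)], the comparison that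
    [real_coef_bounds] asks for. *)
Lemma coef_bounds u (K : R) : (1 <= u < N)%N -> 0 < m (q u) -> N%:R <= K ->
  let s := Num.sqrt (m (q u)) in
  [/\ K^-1 * s^-1 <= coef_a mu cube e a u, coef_a mu cube e a u <= K * s^-1,
      coef_b mu cube e a u <= K * s^-1 & coef_a mu cube e a u * m (q u) <= s].
Proof.
move=> uN q0 NK s.
have y0 : 0 < m (E u.+1) by apply: (measure_tail_gt0 _ q0); lia.
have z0 : 0 < m (E u) by apply: (measure_tail_gt0 _ q0); lia.
have zE : m (E u) = m (q u) + m (E u.+1) by apply: fine_tail_union; lia.
have K1 : 1 <= K by apply: le_trans NK; rewrite ler1n; lia.
have zK : m (E u) <= K * m (E u.+1).
  apply: (@le_trans _ _ (m Q)).
    rewrite fine_le ?ge0_fin_numE ?fcube ?tail_union_finite //; try lia.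
    apply: le_measure; rewrite ?inE; [exact: measurable_tail_union|exact: mcube|].
    by apply: tail_union_sub_cube; lia.
  have := @le_measure_tail u.+1 ltac:(lia) => /le_trans; apply.
  by rewrite ler_wpM2r // ltW.
have := @real_coef_bounds s (Num.sqrt (m (E u.+1))) (Num.sqrt (m (E u))) K.
rewrite !sqrtr_gt0 !sqr_sqrtr ?fine_ge0 //; exact.
Qed.

Lemma haar_abs_le u x (K : R) : (1 <= u < N)%N -> 0 <= K ->
  coef_a mu cube e a u <= K -> coef_b mu cube e a u <= K -> `|h u x| <= K.
Proof.
move=> /andP[u0 uN] K0 aK bK.
have a0 : 0 <= coef_a mu cube e a u by rewrite divr_ge0 ?mulr_ge0 ?sqrtr_ge0.
have b0 : 0 <= coef_b mu cube e a u by rewrite divr_ge0 ?mulr_ge0 ?sqrtr_ge0.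
have [Qx|Qx] := pselect (Q x); last by rewrite haar_supported // normr0.
have [j jN qx] := childP Qx; rewrite (haar_child uN jN qx) /child_value.
case: u u0 {uN} aK bK a0 b0 => // u _ aK bK a0 b0.
have [->|ju] := eqVneq j u.+1; first by rewrite ltnn mulr1 mulr0 subr0 ger0_norm.
rewrite mulr0 sub0r normrN.
by case: ltnP; rewrite ?mulr1 ?mulr0 ?normr0 // ger0_norm.
Qed.

(** By [coef_balance] the parts on [q u] and on [E u.+1] contribute equally, whence the factor 2. *)
Lemma integral_abs_haar u : (1 <= u < N)%N ->
  (\int[mu]_x `|h u x|%:E = (coef_a mu cube e a u * m (q u) *+ 2)%:E)%E.
Proof.
move=> uN.
have a0 : 0 <= coef_a mu cube e a u by rewrite divr_ge0 ?mulr_ge0 ?sqrtr_ge0.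
have b0 : 0 <= coef_b mu cube e a u by rewrite divr_ge0 ?mulr_ge0 ?sqrtr_ge0.
rewrite (eq_integral (fun x => (coef_a mu cube e a u * \1_(q u) x
    - (- coef_b mu cube e a u) * \1_(E u.+1) x)%:E)); last first.
  move=> x _; congr (_%:E); rewrite haarE; last by lia.
  have [qx|qx] := pselect (q u x).
    have nEx : ~ E u.+1 x by apply: (child_notin_tail _ qx); lia.
    by rewrite !indicE (mem_set qx) (memNset nEx) !mulr1 !mulr0 !subr0 ger0_norm.
  rewrite !indicE (memNset qx) !mulr0 !sub0r normrN mulNr opprK.
  by rewrite ger0_norm // mulr_ge0.
rewrite integral_indicB; [|exact: mcube|exact: measurable_tail_union
  |exact: fcube|by apply: tail_union_finite].
by rewrite mulNr opprK -coef_balance ?mulr2n //; lia.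
Qed.

(** The set whose measure sets the scale of [h u]; the case [u = 0] lets one norm estimate cover all
    Haar functions. *)
Definition haar_core u : set X := if u is 0%N then Q else q u.

Lemma haar_core_gt0 u : not_identically_zero (h u) -> 0 < m (haar_core u).
Proof. by case: u => [|u]; [exact: haar0_neq0|exact: haar_neq0]. Qed.

(** [Lp_norm_simeq] applies with constant [2 * K]: [K] controls the coefficients, and the 2 comes
    from the [L^1] norm for [u >= 1]. *)
Lemma haar_Lp_norm u (K : R) (p : \bar R) : (u < N)%N ->
  not_identically_zero (h u) -> N%:R <= K -> (1 <= p)%E ->
  simeq (2 * K) (Lp_norm mu p (h u))
    (m (haar_core u) `^ (exponent_inv p - 2^-1))%:E.
Proof.
move=> uN hu NK; have s0 := haar_core_gt0 hu.
have K1 : 1 <= K by apply: le_trans NK; rewrite ler1n; lia.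
have K0 : 0 < K by exact: lt_le_trans K1.
have mcore : measurable (haar_core u) by case: {uN hu s0} u => [|u]; exact: mcube.
have muE : mu (haar_core u) = (m (haar_core u))%:E.
  by rewrite fineK // ge0_fin_numE //; case: {uN hu s0 mcore} u => [|u]; exact: fcube.
have sN : m (haar_core u) `^ (- 2^-1) = (Num.sqrt (m (haar_core u)))^-1.
  by rewrite powRN powR12_sqrt ?ltW.
have sP : m (haar_core u) `^ 2^-1 = Num.sqrt (m (haar_core u)).
  by rewrite powR12_sqrt ?ltW.
have r0 : 0 < Num.sqrt (m (haar_core u)) by rewrite sqrtr_gt0.
apply: (Lp_norm_simeq _ mcore muE s0) => //.
- by apply/measurable_EFinP; exact: measurable_int (integrable_haar u).
- by lra.
- rewrite sN => x; case: u uN hu s0 {mcore muE sN sP} r0 => [|u] uN hu s0 r0.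
    rewrite /haar indicE; case: (x \in Q); rewrite ?mulr1 ?mulr0 ?normr0.
      by rewrite ger0_norm ?invr_ge0 ?ler_peMl ?invr_ge0 ?ltW //; lra.
    by rewrite mulr_ge0 ?invr_ge0 ?(ltW r0) //; lra.
  have [_ aK bK _] := coef_bounds (u := u.+1) uN s0 NK.
  have le2 : K * (Num.sqrt (m (haar_core u.+1)))^-1
      <= 2 * K * (Num.sqrt (m (haar_core u.+1)))^-1.
    by rewrite ler_wpM2r ?invr_ge0 ?(ltW r0) //; lra.
  apply: haar_abs_le => //; first by rewrite !mulr_ge0 ?invr_ge0 ?ltW.
    exact: le_trans le2.
  exact: le_trans le2.
- rewrite sN => x; case: u uN hu s0 {mcore muE sN sP} r0 => [|u] uN hu s0 r0 /= qx.
    rewrite indicE mem_set // mulr1 ger0_norm ?invr_ge0 ?(ltW r0) //.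
    by rewrite ler_piMl ?invr_ge0 ?(ltW r0) // invf_le1 //; lra.
  have [aK _ _ _] := coef_bounds (u := u.+1) uN s0 NK.
  have uN1 : (1 <= u.+1 <= N)%N by lia.
  rewrite -[X in `|X|]/(h u.+1 x) (haar_child uN uN1 qx) /= eqxx ltnn mulr1 mulr0 subr0.
  apply: le_trans (ler_norm _); apply: le_trans aK.
  by rewrite ler_wpM2r ?invr_ge0 ?(ltW r0) // lef_pV2 ?posrE //; lra.
- rewrite sP; case: u uN hu s0 {mcore muE sN sP} r0 => [|u] uN hu s0 r0.
    rewrite (eq_integral (fun x => ((Num.sqrt (m Q))^-1 * \1_Q x)%:E)); last first.
      by move=> x _; rewrite /haar ger0_norm // mulr_ge0 ?invr_ge0 ?(ltW r0).
    rewrite integral_scale_indic // lee_fin -{2}(sqr_sqrtr (ltW s0)) expr2 mulKf ?gt_eqF //.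
    by rewrite ler_peMl ?(ltW r0) //; lra.
  have [_ _ _ aK] := coef_bounds (u := u.+1) uN s0 NK.
  rewrite integral_abs_haar // lee_fin mulr2n.
  apply: le_trans (lerD aK aK) _.
  rewrite -[leLHS]mul1r mulrDr -mulrDl.
  by rewrite ler_wpM2r ?(ltW r0) //; lra.
Qed.

End Haar.

(** * Uniform constants and assembly of the eight properties *)

Lemma simeqM (R : realType) (c : R) (A B : \bar R) (x y : R) : 0 < c ->
  (0 <= A)%E -> (0 <= B)%E -> 0 <= x -> 0 <= y ->
  simeq c A x%:E -> simeq c B y%:E -> simeq (c * c) (A * B)%E (x * y)%:E.
Proof.
move=> c0 A0 B0 x0 y0 /andP[Ax xA] /andP[By yB].
have cV0 : 0 <= c^-1 by rewrite invr_ge0 ltW.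
apply/andP; split; rewrite ?invfM !EFinM muleACA.
  by apply: lee_pmul => //; rewrite mule_ge0 // lee_fin.
by apply: lee_pmul.
Qed.

Theorem theorem4p8 (R : realType) (d : measure_display) (X : measurableType d)
  (rho : X -> X -> R) (A0 : R) (A1 : nat)
  (hrho : quasi_metric rho A0)
  (hdoubling : geometrically_doubling rho A1)
  (mu : {measure set X -> \bar R})
  (hborel : forall B : set X, qborel rho B -> measurable B)
  (hball : forall (x : X) (r : R), measurable (qball rho x r))
  (hfin : forall (x : X) (r : R), (mu (qball rho x r) < +oo)%E)
  (delta c1 C1 : R) (M : nat) (I : int -> choiceType)
  (cube : forall k : int, I k -> set X) (center : forall k : int, I k -> X)
  (hD : dyadic_system rho delta c1 C1 M cube center)
  (hx0 : distinguished_center center)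
  (e : forall k : int, I k -> nat -> I (k + 1))
  (he : children_indexing mu cube e) :
  (* (i) *)
  (forall (k : int) (a : I k) (u : nat), (u < nchildren cube a)%N ->
     simple_borel rho (haar mu cube e a u)) /\
  (* (ii) *)
  (forall (k : int) (a : I k) (u : nat), (u < nchildren cube a)%N ->
     supported_on (cube k a) (haar mu cube e a u)) /\
  (* (iii) *)
  (forall (k : int) (a : I k) (u : nat), (u < nchildren cube a)%N ->
     constant_on_children cube a (haar mu cube e a u)) /\
  (* (iv) *)
  (forall (k : int) (a : I k) (u : nat), (1 <= u < nchildren cube a)%N ->
     (\int[mu]_x (haar mu cube e a u x)%:E)%E = 0%E) /\
  (* (v) *)
  (forall (k : int) (a : I k) (u v : nat),
     (u < nchildren cube a)%N -> (v < nchildren cube a)%N -> u <> v ->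
     inner mu (haar mu cube e a u) (haar mu cube e a v) = 0%E) /\
  (* (vi) *)
  (forall (k : int) (a : I k),
     orthogonal_basis_ae mu (child_constant_functions cube a)
       (nchildren cube a) (haar mu cube e a) /\
     ((forall b, children cube a b -> (0 < mu (cube (k + 1)%R b))%E) ->
      orthogonal_basis mu (child_constant_functions cube a)
        (nchildren cube a) (haar mu cube e a))) /\
  (* (vii) *)
  (forall p : \bar R, (1 <= p)%E ->
   exists2 c : R, 1 <= c &
   forall (k : int) (a : I k) (u : nat), (1 <= u < nchildren cube a)%N ->
     not_identically_zero (haar mu cube e a u) ->
     simeq c (Lp_norm mu p (haar mu cube e a u))
       (fine (mu (child cube e a u)) `^ (exponent_inv p - 2^-1))%:E) /\
  (* (viii) *)
  (exists2 c : R, 1 <= c &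
   forall (k : int) (a : I k) (u : nat), (u < nchildren cube a)%N ->
     not_identically_zero (haar mu cube e a u) ->
     simeq c (Lp_norm mu 1%:E (haar mu cube e a u)
              * Lp_norm mu +oo (haar mu cube e a u))%E 1%:E).
Proof.
have mcube k (b : I k) : measurable (cube k b) by apply: hborel; exact: (ds_borel hD b).
have fcube k (b : I k) : (mu (cube k b) < +oo)%E.
  apply: le_lt_trans (hfin (center k b) (C1 * delta ^ k)).
  by apply: le_measure; rewrite ?inE //; exact: (ds_outer hD).
have dcube := ds_disjoint hD; have cover_children := ds_children_cover hD.
(* With [M.+1] in place of [M], the constant is at least 1 without a cube at hand. *)
have NM k (b : I k) : (nchildren cube b)%:R <= M.+1%:R :> R.
  by rewrite ler_nat; have /andP[_ /leqW] := ds_children_number hD b.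
have K1 : 1 <= 2 * M.+1%:R :> R by rewrite -natrM ler1n.
split; [|split; [|split; [|split; [|split; [|split; [|split]]]]]].
- by move=> k a u _; apply: haar_simple; exact: (ds_borel hD).
- by move=> k a u; exact: haar_supported.
- by move=> k a u; exact: haar_constant.
- by move=> k a u /andP[u1 _]; exact: integral_haar.
- by move=> k a u v; exact: haar_orthogonal.
- by move=> k a; split; [exact: haar_basis_ae|exact: haar_basis].
- move=> p p1; exists (2 * M.+1%:R) => // k a u /andP[u1 uN] hu.
  have := haar_Lp_norm mcube fcube dcube cover_children he uN hu (NM k a) p1.
  (* For [u >= 1], [haar_core u] reduces to the child of index [u]. *)
  by case: u u1 {uN hu}.
- exists (2 * M.+1%:R * (2 * M.+1%:R)).
    by rewrite -[leLHS]mulr1 ler_pM.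
  move=> k a u uN hu.
  have s0 := haar_core_gt0 hu.
  have Lp := haar_Lp_norm mcube fcube dcube cover_children he uN hu (NM k a).
  set w := fine _ in s0 Lp.
  (* The exponents [1/2] for [p = 1] and [-1/2] for [p = oo] cancel. *)
  have wE : w `^ (exponent_inv 1%:E - 2^-1) * w `^ (exponent_inv +oo%E - 2^-1) = 1.
    rewrite -powRD; last by rewrite (gt_eqF s0) implybT.
    by rewrite /exponent_inv (_ : _ + _ = 0) ?powRr0 //; field.
  have K0 : 0 < 2 * M.+1%:R :> R by exact: lt_le_trans K1.
  rewrite -[X in simeq _ _ X%:E]wE; apply: simeqM; rewrite ?powR_ge0 ?Lnorm_ge0 //.
    exact: Lp.
  by apply: Lp; rewrite leey.
Qed.
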